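(* Let $\alpha=(\alpha_i)_{i\ge1}$, $\beta=(\beta_i)_{i\ge1}$ be sequences of non-negative reals with convergent sums, let $\gamma\ge0$ be real, let $x=(x_1,x_2,\dots)$ be variables, and let $n\ge1$. Then $$\sum_{\lambda:\ \ell(\lambda)\le n}S_\lambda(\alpha,\beta,\gamma)\,s_\lambda(x)=D_n\left(e^{\gamma z}\prod_{r=1}^\infty\frac{1+\beta_rz}{(1-x_r/z)(1-\alpha_rz)}\right),$$ where the sum is over all partitions $\lambda$ with at most $n$ parts.
   Context: **Toeplitz determinants.** For $f(z)=\sum_{k=-\infty}^\infty c_kz^k$, $D_n(f)$ denotes the determinant of the $n\times n$ matrix whose $(i,j)$ entry is $c_{j-i}$, $1\le i,j\le n$. In the claim, the identity is read as one of formal power series in the variables $x_r$, and $c_k$ is the coefficient of $z^k$ obtained by expanding $\prod_r(1-x_r/z)^{-1}$ in powers of $1/z$ and the remaining factors in powers of $z$. **Extended Schur functions.** The extended complete symmetric functions $\tilde h_k(\alpha,\beta,\gamma)$ are defined by $$\sum_{k\ge0}\tilde h_k(\alpha,\beta,\gamma)z^k=e^{\gamma z}\prod_{i\ge1}\frac{1+\beta_iz}{1-\alpha_iz},$$ with $\tilde h_k=0$ for $k<0$. For a partition $\lambda=(\lambda_1,\dots,\lambda_m)$, $S_\lambda(\alpha,\beta,\gamma)=\det(\tilde h_{\lambda_i-i+j})_{i,j=1}^m$. $s_\lambda(x)$ is the usual Schur function and $\ell(\lambda)$ is the number of (nonzero) parts of $\lambda$. *)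

(* Defs.v *)
From HB Require Import structures.
From mathcomp Require Import all_boot all_order all_algebra.
From mathcomp Require Import finmap monalg.
From mathcomp Require Import all_classical all_reals all_analysis.

Set Implicit Arguments.
Unset Strict Implicit.
Unset Printing Implicit Defensive.

Import Order.TTheory GRing.Theory Num.Theory.
Import numFieldNormedType.Exports.

Local Open Scope classical_set_scope.
Local Open Scope ring_scope.

(* Formal power series in countably many variables x_0, x_1, x_2, ...: one
   coefficient for every monomial. *)
Record powser (R : Type) := Powser { pscoef : {cmonom nat} -> R }.

Section PowserRing.
Variable R : comNzRingType.
Implicit Types (F G H : powser R) (d e n : nat) (m : {cmonom nat}) (D : seq {cmonom nat}).

HB.instance Definition _ := gen_eqMixin (powser R).
HB.instance Definition _ := gen_choiceMixin (powser R).

Lemma powserP F G : (forall m, pscoef F m = pscoef G m) -> F = G.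
Proof. by case: F G => [f] [g] /= fg; congr Powser; apply: funext. Qed.

Definition psC (a : R) : powser R :=
  Powser (fun m => a *+ (m == mone)).
Definition psX (r : nat) : powser R :=
  Powser (fun m => (m == ucm r)%:R).
Definition psadd F G : powser R := Powser (fun m => pscoef F m + pscoef G m).
Definition psopp F : powser R := Powser (fun m => - pscoef F m).
Definition psscale (a : R) F : powser R := Powser (fun m => a * pscoef F m).
Definition psmul F G : powser R := Powser (fun m =>
  \sum_(p \in [set p : {cmonom nat} * {cmonom nat} | mmul p.1 p.2 = m])
    pscoef F p.1 * pscoef G p.2).

Lemma psaddA : associative psadd.
Proof. by move=> F G H; apply: powserP => m /=; rewrite addrA. Qed.
Lemma psaddC : commutative psadd.
Proof. by move=> F G; apply: powserP => m /=; rewrite addrC. Qed.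
Lemma psadd0 : left_id (psC 0) psadd.
Proof. by move=> F; apply: powserP => m /=; rewrite mul0rn add0r. Qed.
Lemma psaddN : left_inverse (psC 0) psopp psadd.
Proof. by move=> F; apply: powserP => m /=; rewrite mul0rn addNr. Qed.

HB.instance Definition _ :=
  GRing.isZmodule.Build (powser R) psaddA psaddC psadd0 psaddN.

Lemma divisors_bounded m :
  exists D : seq {cmonom nat}, uniq D /\
    forall a b : {cmonom nat}, mmul a b = m -> a \in D /\ b \in D.
Proof.
pose s : seq nat := finsupp m; pose N := (\max_(i <- s) m i).+1.
have fin : finite_set [set a : {cmonom nat} | forall i, (a i <= m i)%N].
  pose e (f : {ffun seq_sub s -> 'I_N}) : {cmonom nat} :=
    mkcmonom [fsfun i in finsupp m =>
                if insub i is Some j then f j : nat else 0%N | 0%N].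
  apply: (@sub_finite_set _ _ (e @` setT)); last first.
    exact/finite_image/finite_finset.
  move=> a /= am; exists [ffun j => inord (a (val j))] => //.
  apply/eqP/cmP => i; rewrite cmE /= fsfun_fun.
  case: ifPn => [im|im]; last first.
    by apply/esym/eqP; rewrite -leqn0 (leq_trans (am i))// leqn0 cmE_eq0.
  case: insubP => [j _ ji|]; last by rewrite /s im.
  rewrite ffunE inordK ji // /N ltnS (leq_trans (am i)) //.
  exact: (@leq_bigmax_seq _ s xpredT (fun i => m i)).
exists (fset_set [set a : {cmonom nat} | forall i, (a i <= m i)%N]).
split; first exact: fset_uniq.
by move=> a b abm; split; rewrite in_fset_set //; apply: mem_set => i /=;
  rewrite -abm cmM ?leq_addr ?leq_addl.
Qed.

Lemma psmulE F G m D : uniq D ->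
    (forall a b : {cmonom nat}, mmul a b = m -> a \in D /\ b \in D) ->
  pscoef (psmul F G) m =
  \sum_(a <- D) \sum_(b <- D | mmul a b == m) pscoef F a * pscoef G b.
Proof.
move=> uD Dm /=.
pose s := [seq p <- [seq (a, b) | a <- D, b <- D] | mmul p.1 p.2 == m].
have us : uniq s by apply/filter_uniq/allpairs_uniq => // -[? ?] [? ?].
rewrite (_ : [set p | _] = [set` s]).
  by rewrite -fsbig_seq // big_filter big_mkcond big_allpairs /=;
    apply: eq_bigr => a _; rewrite [RHS]big_mkcond.
apply/seteqP; split=> -[a b] /=; rewrite mem_filter /=; last first.
  by case/andP => /eqP.
by move=> abm; rewrite abm eqxx /=; have [aD bD] := Dm _ _ abm; apply/allpairsP;
  exists (a, b).
Qed.


Lemma psmulC : commutative psmul.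
Proof.
move=> F G; apply: powserP => m; have [D [uD Dm]] := divisors_bounded m.
rewrite !(psmulE _ _ uD Dm) (exchange_big_dep xpredT) //=.
by apply: eq_bigr => a _; apply: eq_big => [b|b _];
  [rewrite [mmul a b]mulmC | rewrite mulrC].
Qed.

Lemma psmulA : associative psmul.
Proof.
move=> F G H; apply: powserP => m; have [D [uD Dm]] := divisors_bounded m.
have Dl a b c : mmul (mmul a b) c = m -> [/\ a \in D, b \in D & c \in D].
  move=> abc; have [_ ->] := Dm _ _ abc; rewrite -mulmA in abc.
  have [-> _] := Dm _ _ abc; rewrite mulmA (mulmC a) -mulmA in abc.
  by have [-> _] := Dm _ _ abc.
rewrite !(psmulE _ _ uD Dm).
transitivity (\sum_(a <- D) \sum_(b <- D) \sum_(c <- D)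
   if mmul (mmul a b) c == m then pscoef F a * pscoef G b * pscoef H c else 0).
  apply: eq_bigr => a _.
  transitivity (\sum_(d <- D) \sum_(b <- D) \sum_(c <- D)
     if (mmul b c == d) && (mmul a d == m)
     then pscoef F a * pscoef G b * pscoef H c else 0).
    rewrite big_mkcond; apply: eq_bigr => d _; case: eqP => adm; last first.
      by rewrite big1 // => b _; rewrite big1 // => c _; rewrite andbF.
    rewrite (psmulE _ _ uD) => [|b c bcd]; last first.
      by move: adm; rewrite -bcd mulmA => /Dl[].
    rewrite mulr_sumr; apply: eq_bigr => b _; rewrite mulr_sumr big_mkcond.
    by apply: eq_bigr => c _; rewrite andbT; case: eqP; rewrite ?mulrA.
  rewrite exchange_big; apply: eq_bigr => b _.
  rewrite exchange_big; apply: eq_bigr => c _; rewrite -mulmA.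
  have [abcm|abcm] := eqVneq (mmul a (mmul b c)) m; last first.
    by rewrite big1 // => d _; case: eqP => // <-; rewrite (negPf abcm).
  have [_ bcD] := Dm _ _ abcm.
  rewrite (bigD1_seq (mmul b c)) //= eqxx abcm eqxx big1 ?addr0 // => d.
  by rewrite eq_sym => /negPf ->.
apply/esym.
transitivity (\sum_(d <- D) \sum_(c <- D) \sum_(a <- D) \sum_(b <- D)
     if (mmul a b == d) && (mmul d c == m)
     then pscoef F a * pscoef G b * pscoef H c else 0).
  apply: eq_bigr => d _; rewrite big_mkcond; apply: eq_bigr => c _.
  case: eqP => dcm; last first.
    by rewrite big1 // => a _; rewrite big1 // => b _; rewrite andbF.
  rewrite (psmulE _ _ uD) => [|a b abd]; last first.
    by move: dcm; rewrite -abd => /Dl[].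
  rewrite mulr_suml; apply: eq_bigr => a _; rewrite mulr_suml big_mkcond.
  by apply: eq_bigr => b _; rewrite andbT; case: eqP.
under eq_bigr => d _ do rewrite exchange_big.
rewrite exchange_big; apply: eq_bigr => a _.
under eq_bigr => d _ do rewrite exchange_big.
rewrite exchange_big; apply: eq_bigr => b _.
rewrite exchange_big; apply: eq_bigr => c _.
have [abcm|abcm] := eqVneq (mmul (mmul a b) c) m; last first.
  by rewrite big1 // => d _; case: eqP => // <-; rewrite (negPf abcm).
have [abD _] := Dm _ _ abcm.
rewrite (bigD1_seq (mmul a b)) //= eqxx abcm eqxx big1 ?addr0 // => d.
by rewrite eq_sym => /negPf ->.
Qed.

Lemma pscoefCM a F m : pscoef (psmul (psC a) F) m = a * pscoef F m.
Proof.
have [D [uD Dm]] := divisors_bounded m.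
have [D1 mD] := Dm _ _ (mul1m m).
rewrite (psmulE _ _ uD Dm) (bigD1_seq _ D1) //= [X in _ + X]big1 => [|d d1].
  rewrite addr0 (eq_bigl (pred1 m)) => [|d]; last by rewrite /= mul1m.
  by rewrite -big_filter filter_pred1_uniq // big_seq1 eqxx mulr1n.
by rewrite big1 // => b _; rewrite (negPf d1) mulr0n mul0r.
Qed.

Lemma psmul1 : left_id (psC 1) psmul.
Proof. by move=> F; apply: powserP => m; rewrite pscoefCM mul1r. Qed.

Lemma psmulDl : left_distributive psmul psadd.
Proof.
move=> F G H; apply: powserP => m; have [D [uD Dm]] := divisors_bounded m.
have -> : pscoef (psadd (psmul F H) (psmul G H)) m =
  pscoef (psmul F H) m + pscoef (psmul G H) m by [].
rewrite !(psmulE _ _ uD Dm) -big_split.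
apply: eq_bigr => a _ /=.
by rewrite -big_split; apply: eq_bigr => b _ /=; rewrite mulrDl.
Qed.

Lemma ps1_neq0 : psC 1 != psC 0.
Proof.
apply/eqP => /(congr1 (fun F => pscoef F mone)) /=.
by rewrite eqxx mul0rn; apply/eqP/oner_neq0.
Qed.

HB.instance Definition _ := GRing.Zmodule_isComNzRing.Build (powser R)
  psmulA psmulC psmul1 psmulDl ps1_neq0.

Lemma psscaleA a b F : psscale a (psscale b F) = psscale (a * b) F.
Proof. by apply: powserP => m /=; rewrite mulrA. Qed.
Lemma psscale1 : left_id 1 psscale.
Proof. by move=> F; apply: powserP => m /=; rewrite mul1r. Qed.
Lemma psscaleDr : right_distributive psscale +%R.
Proof. by move=> a F G; apply: powserP => m /=; rewrite mulrDr. Qed.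
Lemma psscaleDl F : {morph psscale^~ F : a b / a + b}.
Proof. by move=> a b; apply: powserP => m /=; rewrite mulrDl. Qed.

HB.instance Definition _ := GRing.Zmodule_isLmodule.Build R (powser R)
  psscaleA psscale1 psscaleDr psscaleDl.

Lemma psscaleAl a F G : a *: (F * G) = (a *: F) * G.
Proof.
have scE c H : c *: H = psC c * H.
  by apply: powserP => m; rewrite [RHS]pscoefCM.
by rewrite !scE mulrA.
Qed.

HB.instance Definition _ := GRing.Lmodule_isLalgebra.Build R (powser R)
  psscaleAl.
HB.instance Definition _ := GRing.Lalgebra_isComAlgebra.Build R (powser R).

Lemma pscoefM_neq0 F G m : pscoef (F * G) m != 0 ->
  exists a b, [/\ m = mmul a b, pscoef F a != 0 & pscoef G b != 0].
Proof.
move=> FGm; apply: contrapT => nex; case/eqP: FGm.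
have [D [uD Dm]] := divisors_bounded m.
rewrite [LHS](psmulE _ _ uD Dm) big1 // => a _; rewrite big1 // => b /eqP abm.
have [->|Fa] := eqVneq (pscoef F a) 0; first by rewrite mul0r.
have [->|Gb] := eqVneq (pscoef G b) 0; first by rewrite mulr0.
by case: nex; exists a, b.
Qed.

Lemma pscoef_sum (I : Type) (r : seq I) (F : I -> powser R) m :
  pscoef (\sum_(i <- r) F i) m = \sum_(i <- r) pscoef (F i) m.
Proof.
by elim/big_rec2: _ => [|i a u _ <-] //=; rewrite mul0rn.
Qed.

Definition pshomog d (F : powser R) :=
  forall m, pscoef F m != 0 -> mdeg m = d.

Lemma pshomog1 : pshomog 0 1.
Proof.
by move=> m /=; case: (eqVneq m mone) => [->|_]; rewrite ?mdeg1 ?eqxx.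
Qed.

Lemma pshomogX r : pshomog 1 (psX r).
Proof.
by move=> m /=; case: (eqVneq m (ucm r)) => [->|_]; rewrite ?mdegU ?eqxx.
Qed.

Lemma pshomogM d e F G : pshomog d F -> pshomog e G -> pshomog (d + e) (F * G).
Proof.
move=> hF hG m /pscoefM_neq0[a [b [-> Fa Gb]]].
by rewrite mdegM (hF a) // (hG b).
Qed.

Lemma pshomogXn d F n : pshomog d F -> pshomog (n * d) (F ^+ n).
Proof.
move=> hF; elim: n => [|n IH]; first by rewrite expr0; apply: pshomog1.
by rewrite exprS mulSn; apply: pshomogM.
Qed.

Lemma pshomog_sum (I : Type) (r : seq I) (F : I -> powser R) d :
  (forall i, pshomog d (F i)) -> pshomog d (\sum_(i <- r) F i).
Proof.
move=> hF m; rewrite pscoef_sum; apply: contra_neq_eq => dm.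
by rewrite big1 // => i _; apply: contra_neq_eq dm => /hF.
Qed.

(* An infinite sum of power series makes sense when every monomial occurs in
   only finitely many of the terms ([pssummable]); [pssum] is junk otherwise. *)
Definition pssummable (I : choiceType) (A : set I) (F : I -> powser R) :=
  forall m, finite_set (A `&` [set i | pscoef (F i) m != 0]).
Definition pssum (I : choiceType) (A : set I) (F : I -> powser R) : powser R :=
  Powser (fun m => \sum_(i \in A) pscoef (F i) m).
Definition has_pssum (I : choiceType) (A : set I) (F : I -> powser R) G :=
  pssummable A F /\ pssum A F = G.

End PowserRing.

(* A power series in one variable z over K is its sequence of coefficients. *)
Section Series.
Variable K : comNzRingType.
Implicit Types (a b c : nat -> K).

Definition ser1 : nat -> K := fun k => (k == 0%N)%:R.
Definition sermul a b : nat -> K := fun k => \sum_(i < k.+1) a i * b (k - i)%N.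
(* 1 + u z *)
Definition ser1D (u : K) : nat -> K := fun k => [:: 1; u]`_k.
(* 1 / (1 - u z) *)
Definition sergeo (u : K) : nat -> K := fun k => u ^+ k.

Let tr n a := \poly_(i < n.+1) a i.

Lemma sermulE n a b k : (k <= n)%N -> sermul a b k = (tr n a * tr n b)`_k.
Proof.
move=> kn; rewrite coefM; apply: eq_bigr => i _; rewrite !coef_poly !ltnS.
by rewrite (leq_trans (leq_ord i) kn) (leq_trans (leq_subr _ _) kn).
Qed.

Lemma sermulA : associative sermul.
Proof.
move=> a b c; apply/funext => k; rewrite !(sermulE _ _ (leqnn k)).
transitivity ((tr k a * (tr k b * tr k c))`_k).
  rewrite !(coefM (tr k a)); apply: eq_bigr => i _; congr (_ * _).
  by rewrite coef_poly ltnS leq_subr (sermulE (n := k)) ?leq_subr.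
rewrite mulrA coefMr [RHS]coefMr; apply: eq_bigr => i _; congr (_ * _).
by rewrite coef_poly ltnS leq_subr (sermulE (n := k)) ?leq_subr.
Qed.

Lemma sermulC : commutative sermul.
Proof.
by move=> a b; apply/funext => k; rewrite !(sermulE _ _ (leqnn k)) mulrC.
Qed.

Lemma sermul1 : left_id ser1 sermul.
Proof.
move=> a; apply/funext => k; rewrite /sermul big_ord_recl /= mul1r subn0.
by rewrite big1 ?addr0 // => i _; rewrite mul0r.
Qed.

HB.instance Definition _ :=
  Monoid.isComLaw.Build (nat -> K) ser1 sermul sermulA sermulC sermul1.

(* [c k] is the coefficient of z^k in the symbol. *)
Definition toeplitz_det (n : nat) (c : int -> K) : K :=
  \det (\matrix_(i < n, j < n) c (j%:Z - i%:Z)).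

End Series.

Section ExtendedSchur.
Variable R : realType.
Implicit Types (alpha beta : R^nat) (gamma : R) (lam : seq nat).

(* e^(gamma z) \prod_(i < N) (1 + beta_i z) / (1 - alpha_i z) *)
Definition zfactor_trunc alpha beta gamma (N : nat) : R^nat :=
  sermul (exp_coeff gamma)
    (\big[@sermul R/@ser1 R]_(i < N)
      sermul (ser1D (beta i)) (sergeo (alpha i))).

(* Infinite products of power series are limits in the topology of
   coefficientwise convergence; the limit exists by [zfactor_trunc_cvg]. *)
Definition zfactor alpha beta gamma : R^nat :=
  fun k => limn (fun N => zfactor_trunc alpha beta gamma N k).

Lemma zfactor_trunc_cvg alpha beta gamma k :
    (forall i, 0 <= alpha i) -> (forall i, 0 <= beta i) ->
    cvgn (series alpha) -> cvgn (series beta) ->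
  cvgn (fun N => zfactor_trunc alpha beta gamma N k).
Proof.
move=> a0 b0 ca cb; pose f i := sermul (ser1D (beta i)) (sergeo (alpha i)).
pose p N := \big[@sermul R/@ser1 R]_(i < N) f i.
have fS i l : f i l.+1 = alpha i ^+ l * (alpha i + beta i).
  rewrite /f /sermul big_ord_recl big_ord_recl big1 => [|j _].
    by rewrite addr0 /sergeo /ser1D /= subn0 subSS subn0 mul1r exprSr mulrDr
      [_ * beta i]mulrC.
  by rewrite /ser1D /= nth_nil mul0r.
have f1 i : f i 0 = 1 by rewrite /f /sermul big_ord1 mul1r.
have f0 i l : 0 <= f i l.
  by case: l => [|l]; rewrite ?f1 // fS mulr_ge0 ?exprn_ge0 ?addr_ge0.
have pS N l : p N.+1 l = p N l + \sum_(j < l) p N j * f N (l - j)%N.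
  by rewrite /p big_ord_recr /= [LHS]big_ord_recr /= subnn f1 mulr1 addrC.
have p0 N l : 0 <= p N l.
  elim: N l => [|N IH] l; first by rewrite /p big_ord0 /ser1; case: eqP.
  by rewrite pS addr_ge0 // sumr_ge0 // => j _; rewrite mulr_ge0.
pose s N := series alpha N + series beta N.
have [M sM] : exists M, forall N, s N <= M.
  have /cvg_seq_bounded[M [_ MB]] : cvgn s by apply: is_cvgD.
  exists (M + 1) => N; apply: le_trans (ler_norm _) _.
  by apply: MB; rewrite ?ltrDl.
have sS N : s N.+1 = s N + (alpha N + beta N).
  by rewrite /s !seriesSr addrACA.
have s0 N : 0 <= s N by rewrite addr_ge0 // sumr_ge0.
have aM i : alpha i <= M.
  apply: le_trans (sM i.+1); rewrite sS -[leLHS]add0r lerD // lerDl //.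
have M0 : 0 <= M by apply: le_trans (a0 0) (aM 0).
have pB l : exists2 B, 0 <= B & forall N, p N l <= B.
  elim/ltn_ind: l => l IH.
  have [B [B0 pB]] : exists B : nat -> R, (forall j, (j < l)%N -> 0 <= B j) /\
      forall j N, (j < l)%N -> p N j <= B j.
    have /choice[B HB] j : exists b : R,
        (j < l)%N -> 0 <= b /\ forall N, p N j <= b.
      by have [/IH[b b_ge0 pb]|] := ltnP j l; [exists b | exists 0].
    by exists B; split=> [j /HB[]|j N /HB[]].
  pose C := \sum_(j < l) B j * M ^+ (l - j).-1.
  have C0 : 0 <= C by apply: sumr_ge0 => j _; rewrite mulr_ge0 ?exprn_ge0 ?B0.
  have pC N : p N l <= 1 + C * s N.
    elim: N => [|N IHN].
      rewrite /p big_ord0 /ser1 (le_trans (y := 1)) ?lerDl ?mulr_ge0 //.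
      by case: eqP.
    rewrite pS sS mulrDr addrA lerD // /C mulr_suml ler_sum // => j _.
    have -> : (l - j = (l - j).-1.+1)%N by rewrite prednK // subn_gt0.
    rewrite fS -mulrA ler_pM ?p0 ?pB ?mulr_ge0 ?exprn_ge0 ?addr_ge0 //=.
    by rewrite ler_wpM2r ?addr_ge0 // lerXn2r ?nnegrE.
  exists (1 + C * M) => [|N]; first by rewrite addr_ge0 ?mulr_ge0.
  by apply: le_trans (pC N) _; rewrite lerD2l ler_wpM2l.
have pcvg l : cvgn (p^~ l).
  apply: nondecreasing_is_cvgn.
    apply/nondecreasing_seqP => N; rewrite pS lerDl sumr_ge0 // => j _.
    by rewrite mulr_ge0.
  by have [B _ pB'] := pB l; exists B => _ [N _ <-].
rewrite (_ : (fun N => _) = \sum_(i < k.+1)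
    (fun N => exp_coeff gamma i * p N (k - i)%N)).
  elim/big_ind: _ => [|u v cu cv|i _]; [exact: is_cvg_cst | exact: is_cvgD |].
  by apply: is_cvgM; [exact: is_cvg_cst | exact: pcvg].
by apply/funext => N; rewrite fct_sumE.
Qed.

Definition ext_h alpha beta gamma (k : int) : R :=
  if k is Posz k' then zfactor alpha beta gamma k' else 0.

(* Partitions are listed without zero parts, so that [size] is the length. *)
Definition is_partition lam : bool := sorted geq lam && (0 \notin lam)%N.

Definition ext_schur alpha beta gamma lam : R :=
  \det (\matrix_(i < size lam, j < size lam)
    ext_h alpha beta gamma ((nth 0%N lam i)%:Z - i%:Z + j%:Z)).

(* T lists the rows of a filling, with entries the indices of the variables. *)
Definition semistandard lam (T : seq (seq nat)) : Prop :=
  [/\ shape T = lam,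
      all (sorted leq) T &
      forall i j, (j < size (nth [::] T i.+1))%N ->
        (nth 0 (nth [::] T i) j < nth 0 (nth [::] T i.+1) j)%N].

Definition schur lam : powser R :=
  pssum [set T | semistandard lam T]
    (fun T => \prod_(r <- flatten T) psX R r).

Lemma schur_summable lam : pssummable [set T | semistandard lam T]
  (fun T => \prod_(r <- flatten T) psX R r).
Proof.
move=> m; pose n := sumn lam; pose S := seq_sub (finsupp m : seq nat).
apply: (@sub_finite_set _ _
  ((fun t : n.-tuple S => reshape lam (map val t)) @` setT)); last first.
  exact/finite_image/finite_finset.
move=> T [[shT _ _] /= nz].
have sub : all (fun r => r \in finsupp m) (flatten T).
  elim: (flatten T) m nz {S} => //= r s IH m.
  rewrite big_cons => /pscoefM_neq0[a [b [-> Xa Fb]]].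
  have -> : a = ucm r.
    by move: Xa => /=; case: (eqVneq a (ucm r)) => //; rewrite eqxx.
  rewrite -cmE_neq0 cmM addn_eq0 negb_and ucmE eqxx /=.
  apply: sub_all (IH _ Fb) => i ib; rewrite -cmE_neq0 cmM.
  by rewrite addn_eq0 negb_and orbC cmE_neq0 ib.
have szT : size (pmap (insub : nat -> option S) (flatten T)) == n.
  by rewrite size_pmap_sub /n -shT -size_flatten; move: sub; rewrite all_count.
exists (Tuple szT) => //=.
rewrite -[RHS]flattenK shT; congr reshape.
rewrite (pmap_filter (@insubK _ _ _)); apply/all_filterP.
by apply: sub_all sub => r rm /=; rewrite isSome_insub.
Qed.

(* \prod_r 1 / (1 - x_r w) as a power series in w, with w standing for 1/z; the
   coefficients at a given monomial are eventually constant in N. *)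
Definition xfactor (j : nat) : powser R :=
  Powser (fun m => limn (fun N =>
    pscoef ((\big[@sermul (powser R)/@ser1 (powser R)]_(r < N)
              sergeo (psX R r)) j) m)).

Lemma xfactor_homog j : pshomog j (xfactor j).
Proof.
have hN N : forall j, pshomog j ((\big[@sermul (powser R)/@ser1 (powser R)]_(r < N)
    sergeo (psX R r)) j).
  elim: N => [|N IH] {}j; rewrite ?big_ord0 ?big_ord_recr /=.
    by rewrite /ser1; case: j => [|j] m /=; [apply: pshomog1 | rewrite mul0rn eqxx].
  rewrite /sermul; apply: pshomog_sum => i.
  rewrite -[X in pshomog X](subnKC (leq_ord i)); apply: pshomogM => //.
  by rewrite -[X in pshomog X]muln1; apply/pshomogXn/pshomogX.
move=> m /=; apply: contra_neq_eq => mj.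
under eq_fun => N do rewrite (contra_neq_eq (hN N j m)) //.
exact: lim_cst.
Qed.

(* The coefficient of z^k in the product of [zfactor] in z and [xfactor]
   in 1/z. *)
Definition symbol_coef alpha beta gamma (k : int) : powser R :=
  pssum [set p : nat * nat | p.1%:Z - p.2%:Z = k]
    (fun p => zfactor alpha beta gamma p.1 *: xfactor p.2).

Lemma symbol_summable alpha beta gamma (k : int) :
  pssummable [set p : nat * nat | p.1%:Z - p.2%:Z = k]
    (fun p => zfactor alpha beta gamma p.1 *: xfactor p.2).
Proof.
move=> m.
apply: (@sub_finite_set _ _ [set (`|(k + (mdeg m)%:Z)%R|%N, mdeg m)]).
  move=> [l j] [/= <-] lj; have Fj : pscoef (xfactor j) m != 0.
    by apply: contra_neq lj => /= ->; rewrite mulr0.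
  by rewrite (xfactor_homog Fj) subrK absz_nat.
exact: finite_set1.
Qed.

End ExtendedSchur.

(* Main.v *)
Require Import Defs.
From mathcomp Require Import all_boot all_order all_algebra.
From mathcomp Require Import finmap monalg.
From mathcomp Require Import all_classical all_reals all_analysis.

(* Multiplying the symbol [c] by [1 / (1 - x / z)] gives [c'] with
   [c'_k = c_k + x c'_(k+1)].  Subtracting from each row of
   [det (c'_(lam_i - i + j))] a multiple of the previous one leaves finite sums
   over disjoint ranges, and multilinearity yields
     [T_lam c' = \sum_mu x ^ |mu / lam| T_mu c],
   over the horizontal strips [mu / lam], where [T_lam c] is the determinant
   [det (c_(lam_i - i + j))].  Starting from the empty partition and introducing
   the variables one at a time, the Toeplitz determinant becomes the sum over
   [mu] of [T_mu c] times the number of chains of horizontal strips from the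
   empty partition to [mu], weighted by monomials; such chains are the
   semistandard tableaux of shape [mu].
   The coefficient of a monomial [m] depends only on the variables dividing [m]
   and on the coefficients of [z ^ k] with [k <= deg m + n], which makes
   everything finite. *)

Set Implicit Arguments.
Unset Strict Implicit.
Unset Printing Implicit Defensive.

Import Order.TTheory GRing.Theory Num.Theory.
Import numFieldNormedType.Exports.
Local Open Scope classical_set_scope.
Local Open Scope ring_scope.

(** * Determinants of shifted coefficients and horizontal strips *)

Section Gessel.
Variables (A : comNzRingType) (n K : nat).
Implicit Types (b : nat -> A) (x : A) (l : seq nat) (k : int).

(* A sequence [b] stands for the Laurent series
   [\sum_p b p * z ^ (K - p)] in [1/z]. *)
Definition wcoef b k : A := if K%:Z - k is Posz p then b p else 0.

(** On the zero list this is the Toeplitz determinant of the series; on a partition it is the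
    [T_lam c] of the overview. *)
Definition wdet b l : A :=
  \det (\matrix_(i < n, j < n) wcoef b ((nth 0%N l i)%:Z - i%:Z + j%:Z)).

(** The weakly decreasing [f] encode the partitions in an [n] by [K] box, padded with zeros. A
    finite type allows ordinary big sums; monotonicity is a separate condition. *)
Definition part (f : {ffun 'I_n -> 'I_K.+1}) : seq nat :=
  [seq val (f i) | i <- enum 'I_n].

Lemma size_part f : size (part f) = n.
Proof. by rewrite size_map size_enum_ord. Qed.

Lemma nth_part f (i : 'I_n) : nth 0%N (part f) i = f i.
Proof. by rewrite (nth_map i) ?size_enum_ord // nth_ord_enum. Qed.

Lemma part_inj : injective part.
Proof.
by move=> f g fg; apply/ffunP => i; apply: val_inj; rewrite /= -!nth_part fg.
Qed.

(* The bound [mu_i <= lam_(i-1)] of a horizontal strip [mu / lam], with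
   [lam_(-1) = K]. *)
Definition strip_bound l i : nat := if i is i'.+1 then nth 0%N l i' else K.

Definition in_strip l i (v : nat) : bool :=
  (nth 0%N l i <= v <= strip_bound l i)%N.

Definition hstrip (f g : {ffun 'I_n -> 'I_K.+1}) : bool :=
  [forall i : 'I_n, in_strip (part f) i (g i)].

Lemma sermul_geoS b x p :
  sermul b (sergeo x) p.+1 = b p.+1 + x * sermul b (sergeo x) p.
Proof.
rewrite /sermul big_ord_recr /= subnn /sergeo expr0 mulr1 addrC; congr (_ + _).
rewrite mulr_sumr; apply: eq_bigr => i _.
by rewrite subSn ?leq_ord // exprS mulrCA.
Qed.

Lemma wcoef_geo b x k :
  wcoef (sermul b (sergeo x)) k =
  wcoef b k + x * wcoef (sermul b (sergeo x)) (k + 1).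
Proof.
rewrite /wcoef opprD addrA; case: (K%:Z - k) => [[|p]|p].
- by rewrite /= /sermul big_ord1 /sergeo expr0 mulr1 mulr0 addr0.
- by rewrite sermul_geoS -addn1 PoszD addrK.
- by rewrite NegzE -opprD -PoszD addn1 /= mulr0 addr0.
Qed.

Lemma wcoef_geo_iter b x k p :
  wcoef (sermul b (sergeo x)) k =
  \sum_(t < p) x ^+ t * wcoef b (k + t%:Z) +
  x ^+ p * wcoef (sermul b (sergeo x)) (k + p%:Z).
Proof.
elim: p => [|p IH]; first by rewrite big_ord0 add0r expr0 mul1r addr0.
rewrite big_ord_recr /= -addrA IH; congr (_ + _).
by rewrite wcoef_geo mulrDr exprSr mulrA -addrA -PoszD addn1.
Qed.

(** The interval from [a] to [u] will be the range of [mu_i] in a horizontal strip, and the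
    remainder a multiple of an entry of the previous row. For [a = u.+1] the interval is empty. *)
Lemma wcoef_geo_interval b x (u a : nat) (e : int) :
    (u <= K)%N -> (a <= u.+1)%N ->
  wcoef (sermul b (sergeo x)) (a%:Z + e) =
  \sum_(v < K.+1 | (a <= v <= u)%N) x ^+ (v - a) * wcoef b (v%:Z + e) +
  x ^+ (u.+1 - a) * wcoef (sermul b (sergeo x)) (u.+1%:Z + e).
Proof.
move=> uK au; rewrite (wcoef_geo_iter _ _ _ (u.+1 - a)) addrAC -PoszD subnKC //.
congr (_ + _); transitivity (\sum_(a <= v < u.+1) x ^+ (v - a) * wcoef b (v%:Z + e)).
  rewrite -[X in \sum_(X <= _ < _) _]add0n big_addn big_mkord; apply: eq_bigr => t _.
  by rewrite addnK PoszD addrAC [a%:Z + _]addrC.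
rewrite (big_nat_widen _ _ K.+1) // big_geq_mkord; apply: eq_bigl => v /=.
by rewrite ltnS andbC.
Qed.

Lemma wcoef_gt b k : K%:Z < k -> wcoef b k = 0.
Proof.
rewrite /wcoef -subr_lt0; case: (K%:Z - k) => // p.
Qed.

Lemma wdet_geo b x (f : {ffun 'I_n -> 'I_K.+1}) : sorted geq (part f) ->
  wdet (sermul b (sergeo x)) (part f) =
  \sum_(g | hstrip f g) x ^+ (\sum_i (g i - f i)) * wdet b (part g).
Proof.
move=> sf; set b' := sermul _ _; set l := part f.
have lK i : (nth 0%N l i <= K)%N.
  have [ni|ni] := leqP n i; first by rewrite nth_default // size_part.
  by rewrite (nth_part f (Ordinal ni)) -ltnS.
have lS i : (nth 0%N l i.+1 <= nth 0%N l i)%N.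
  have [ni|ni] := leqP n i.+1; first by rewrite nth_default // size_part.
  by have /sortedP := sf; apply; rewrite size_part.
pose M : 'M[A]_n := \matrix_(i, j) wcoef b' ((nth 0%N l i)%:Z - i%:Z + j%:Z).
(* Left multiplication by [1%:M - L] subtracts from each row the multiple of the previous one that
   cancels the remainder in [wcoef_geo_interval]. *)
pose L : 'M[A]_n := \matrix_(i, j)
  if i == j.+1 :> nat then x ^+ ((nth 0%N l j).+1 - nth 0%N l i) else 0.
pose B : 'M[A]_n := \matrix_(i, j) \sum_(v < K.+1 | in_strip l i v)
  x ^+ (v - nth 0%N l i) * wcoef b (v%:Z - i%:Z + j%:Z).
have BE : B = (1%:M - L) *m M.
  apply/matrixP => i j; rewrite mulmxBl mul1mx !mxE.
  rewrite -[X in wcoef b' X]addrA.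
  rewrite (wcoef_geo_interval b x (u := strip_bound l i)); last 2 first.
  - by rewrite /strip_bound; case: (val i).
  - by rewrite /strip_bound; case: (val i) => [|i']; exact: leqW.
  rewrite -/b' [in RHS](eq_bigr (fun v : 'I_K.+1 =>
    x ^+ (v - nth 0%N l i) * wcoef b (v%:Z - i%:Z + j%:Z))); last first.
    by move=> v _; rewrite addrA.
  have [[j0 ij0]|i0] := pselect (exists j0 : 'I_n, i = j0.+1 :> nat); last first.
    have i0' : val i = 0%N.
      case: i i0 => -[|i] //= ni []; by exists (Ordinal (ltnW ni)).
    (* In row 0 the upper bound is [K], so the remainder involves a power of [z] beyond [K], whose
       coefficient is 0. *)
    rewrite wcoef_gt ?mulr0 ?addr0; last first.
      by rewrite i0' /= addrA subr0 -PoszD ltz_nat ltnS leq_addr.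
    rewrite [X in _ - X]big1 ?subr0 // => j1 _; rewrite !mxE ifF ?mul0r //.
    by apply/eqP => ij1; apply: i0; exists j1.
  rewrite [X in _ - X](bigD1 j0) //= [X in _ - (_ + X)]big1 => [|j1 j10]; last first.
    by rewrite !mxE ij0 eqSS ifF ?mul0r // eq_sym; exact/negbTE.
  rewrite !mxE addr0 ij0 eqxx /=.
  (* The index [lam_(i-1) + 1 - i + j] of the remainder is that of the entry in row [i - 1]. *)
  have -> : (nth 0%N l j0)%:Z - j0%:Z + j%:Z =
            (nth 0%N l j0).+1%:Z + (- j0.+1%:Z + j%:Z).
    by rewrite (intS (nth _ _ _)) (intS j0) opprD !addrA [1 + _]addrC addrK.
  by rewrite addrK.
have -> : wdet b' l = \det B.
  rewrite BE det_mulmx det_trig; last first.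
    apply/is_trig_mxP => i j ij; rewrite !mxE ifF ?subr0.
      by rewrite -val_eqE /= (ltn_eqF ij).
    by apply/negbTE; rewrite neq_ltn (leq_trans ij).
  rewrite big1 ?mul1r // => i _; rewrite !mxE eqxx ifF ?subr0 //.
  by apply/negbTE; rewrite neq_ltn ltnSn.
(* Multilinearity: a term of the expansion picks one [mu_i] from the interval of each row, that is,
   a horizontal strip [g]. *)
rewrite /determinant.
under eq_bigr => s _.
  under eq_bigr => i _ do rewrite mxE.
  rewrite (bigA_distr_big_dep (fun (i : 'I_n) (v : 'I_K.+1) => in_strip l i v)) mulr_sumr.
  over.
rewrite exchange_big /=; apply: eq_big => [g|g _].
  by apply/familyP/forallP.
rewrite mulr_sumr; apply: eq_bigr => s _; rewrite big_split /= mulrCA.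
rewrite -prodrXr; congr (_ * (_ * _)); apply: eq_bigr => i _.
  by rewrite nth_part.
by rewrite mxE nth_part.
Qed.

(** The interlacing inequalities hold for every natural index because parts past [n] read as 0; the
    bound [K] on the first part comes from the type of [g]. *)
Lemma hstripP (f g : {ffun 'I_n -> 'I_K.+1}) :
  reflect (forall i, (nth 0%N (part f) i <= nth 0%N (part g) i)%N /\
                     (nth 0%N (part g) i.+1 <= nth 0%N (part f) i)%N)
          (hstrip f g).
Proof.
apply: (iffP forallP) => fg i; last first.
  rewrite /in_strip -nth_part (fg i).1 /=; case: i => -[|i] ni /=.
    by rewrite (nth_part g (Ordinal ni)) -ltnS.
  exact: (fg i).2.
have {}fg j (nj : (j < n)%N) : (nth 0%N (part f) j <= nth 0%N (part g) j <=
    strip_bound (part f) j)%N.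
  by have := fg (Ordinal nj); rewrite /in_strip -(nth_part g (Ordinal nj)).
split.
  have [ni|ni] := leqP n i; first by rewrite nth_default // size_part.
  by have /andP[] := fg _ ni.
have [ni|ni] := leqP n i.+1; first by rewrite nth_default // size_part.
by have /andP[] := fg _ ni.
Qed.

Lemma hstrip_sorted f g : hstrip f g -> sorted geq (part g).
Proof.
move=> /hstripP fg; apply/(sortedP 0%N) => i _ /=.
exact: leq_trans (fg i).2 (fg i).1.
Qed.

(** Fills the cells of the strip [m / l] with [N], which is to exceed every entry of [T]. *)
Definition add_letter (N : nat) (l m : seq nat) (T : seq (seq nat)) :=
  mkseq (fun i => nth [::] T i ++ nseq (nth 0%N m i - nth 0%N l i) N) n.

(* The semistandard tableaux of shape [g] with entries below [N], written with
   [n] rows, some of them possibly empty. *)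
Fixpoint ssyt (N : nat) (g : {ffun 'I_n -> 'I_K.+1}) : seq (seq (seq nat)) :=
  if N is N'.+1 then
    [seq add_letter N' (part f) (part g) T |
       f <- [seq f <- enum {ffun 'I_n -> 'I_K.+1} | hstrip f g], T <- ssyt N' f]
  else if g == [ffun=> ord0] then [:: nseq n [::]] else [::].

Lemma ssytSP N g T' : reflect
  (exists f T, [/\ hstrip f g, T \in ssyt N f &
                   T' = add_letter N (part f) (part g) T])
  (T' \in ssyt N.+1 g).
Proof.
apply: (iffP allpairsPdep) => -[f [T [fg Tf ->]]]; exists f, T; split => //.
  by move: fg; rewrite mem_filter => /andP[].
by rewrite mem_filter fg mem_enum.
Qed.

Lemma part0E : part [ffun=> ord0] = nseq n 0%N.
Proof.
apply: (@eq_from_nth _ 0%N); rewrite size_part ?size_nseq // => i ni.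
by rewrite (nth_part _ (Ordinal ni)) ffunE nth_nseq ni.
Qed.

Lemma ssyt_sorted N g T : T \in ssyt N g -> sorted geq (part g).
Proof.
case: N => [|N] /=; last by case/(ssytSP N) => f [T1 [/hstrip_sorted]].
case: eqP => // -> _; rewrite part0E; apply/(sortedP 0%N) => i.
by rewrite size_nseq => ni; rewrite !nth_nseq ni (ltnW ni).
Qed.

Lemma size_ssyt N g T : T \in ssyt N g -> size T = n.
Proof.
case: N => [|N] /=; last by case/(ssytSP N) => f [T1 [_ _ ->]]; rewrite size_mkseq.
by case: eqP => // _; rewrite inE => /eqP ->; rewrite size_nseq.
Qed.

Lemma prod_add_letter (X : nat -> A) N f g T : size T = n ->
  \prod_(r <- flatten (add_letter N (part f) (part g) T)) X r =
  \prod_(r <- flatten T) X r * X N ^+ (\sum_i (g i - f i)).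
Proof.
move=> sT; rewrite !big_flatten [in RHS](big_nth [::]) sT big_map.
have -> : iota 0 n = index_iota 0 n by rewrite /index_iota subn0.
rewrite !big_mkord -prodrXr -big_split.
apply: eq_bigr => i _ /=; rewrite big_cat big_nseq -!nth_part.
by rewrite iter_mulr_1.
Qed.

(** Induction on [N] for all [b]: the last factor is absorbed into [b], and [wdet_geo] then expands
    each determinant given by the induction hypothesis, lengthening the chains by one strip. *)
Lemma wdet_prod_geo (X : nat -> A) N b :
  wdet (sermul b (\big[@sermul A/@ser1 A]_(r < N) sergeo (X r))) (nseq n 0%N) =
  \sum_g wdet b (part g) * \sum_(T <- ssyt N g) \prod_(r <- flatten T) X r.
Proof.
rewrite -part0E; elim: N b => [|N IH] b.
  rewrite big_ord0 sermulC sermul1 (bigD1 [ffun=> ord0]) //= eqxx big_seq1.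
  rewrite [X in _ * X]big1_seq; last first.
    move=> r /andP[_ /flattenP[s]]; rewrite mem_nseq => /andP[_ /eqP ->] //.
  by rewrite mulr1 big1 ?addr0 // => g /negbTE ->; rewrite big_nil mulr0.
rewrite big_ord_recr /= [sermul (\big[_/_]_(_ < _) _) _]sermulC sermulA IH.
transitivity (\sum_f \sum_(g | hstrip f g) wdet b (part g) *
   \sum_(T <- ssyt N f) \prod_(r <- flatten (add_letter N (part f) (part g) T)) X r).
  apply: eq_bigr => f _.
  (* [wdet_geo] needs [part f] sorted. A tableau of shape [f] guarantees this, and without one both
     sides vanish. *)
  case ET: (ssyt N f) => [|T0 s].
    by rewrite big_nil mulr0 big1 // => g _; rewrite big_nil mulr0.
  rewrite -ET wdet_geo; last by apply: (@ssyt_sorted N f T0); rewrite ET inE eqxx.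
  rewrite mulr_suml; apply: eq_bigr => g _; rewrite -mulrA mulrCA; congr (_ * _).
  rewrite mulr_sumr; apply: eq_big_seq => T /size_ssyt sT.
  by rewrite prod_add_letter // mulrC.
rewrite (exchange_big_dep predT) //=; apply: eq_bigr => g _.
by rewrite big_allpairs_dep big_filter mulr_sumr big_enum_cond.
Qed.

End Gessel.

(** * Chains of horizontal strips are semistandard tableaux *)

Section Tableaux.
Implicit Types (l : seq nat) (T : seq (seq nat)) (N : nat).

Local Notation below N := (seq.filter (fun r => r < N)%N).

Lemma sorted_leq_nseq s k N :
  all (fun r => r < N)%N s -> sorted leq s -> sorted leq (s ++ nseq k N).
Proof.
move=> sN ss; rewrite sorted_pairwise; last exact: leq_trans.
rewrite pairwise_cat -(sorted_pairwise leq_trans) ss; apply/and3P; split => //.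
  apply/allrelP => a c /(allP sN) /ltnW aN.
  by rewrite mem_nseq => /andP[_ /eqP ->].
by elim: k => //= k ->; rewrite all_nseq leqnn orbT.
Qed.

(** Undoes [add_letter] on a single row: the copies of the largest letter stand at the end. *)
Lemma sorted_filter_ltn s N : sorted leq s -> all (fun r => r < N.+1)%N s ->
  s = below N s ++
      nseq (size s - size (below N s)) N.
Proof.
elim: s => //= a s IH as_ /andP[aN sN].
have [aN'|aN'] /= := ltnP a N.
  by rewrite subSS -IH // (path_sorted as_).
have aE : a = N by apply/eqP; rewrite eqn_leq -ltnS aN.
have sE : all (pred1 N) s.
  apply/allP => c cs /=; rewrite eqn_leq -ltnS (allP sN) //= -aE.
  by have /allP -> := order_path_min leq_trans as_.
have -> : below N s = [::].
  apply/eqP; rewrite -(negbK (_ == _)) -has_filter -all_predC.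
  by apply: sub_all sE => c /eqP -> /=; rewrite ltnn.
by rewrite subn0 aE /= {1}(all_pred1P _ _ sE).
Qed.

Lemma all_flatten (a : pred nat) T : all a (flatten T) = all (all a) T.
Proof. by elim: T => //= r T IH; rewrite all_cat IH. Qed.

Lemma nth_sorted_geq l i : sorted geq l -> (nth 0%N l i.+1 <= nth 0%N l i)%N.
Proof.
move=> /(sortedP 0%N) sl; have [li|li] := ltnP i.+1 (size l); first exact: sl.
by rewrite nth_default.
Qed.

(** A form without index bounds, missing rows being read as empty, so that tableaux can be compared
    with strips row by row. *)
Lemma semistandardP l T N :
  (semistandard l T /\ all (fun r => r < N)%N (flatten T)) <->
  size T = size l /\ forall i,
    [/\ size (nth [::] T i) = nth 0%N l i, sorted leq (nth [::] T i),
        all (fun r => r < N)%N (nth [::] T i) &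
        forall j, (j < nth 0%N l i.+1)%N ->
          (nth 0 (nth [::] T i) j < nth 0 (nth [::] T i.+1) j)%N].
Proof.
split=> [[[sh so co] aN]|[sT H]].
  have sz i : size (nth [::] T i) = nth 0%N l i by rewrite -sh nth_shape.
  split; first by rewrite -sh size_map.
  move=> i; split => // [||j jl]; last by apply: co; rewrite sz.
    have [Ti|Ti] := ltnP i (size T); last by rewrite nth_default.
    by move/allP: so; apply; exact: mem_nth.
  have [Ti|Ti] := ltnP i (size T); last by rewrite nth_default.
  move: aN; rewrite all_flatten => /allP; apply; exact: mem_nth.
split; first split.
- apply: (@eq_from_nth _ 0%N); rewrite ?size_map // => i _.
  by rewrite nth_shape; case: (H i).
- by apply/(all_nthP [::]) => i _; case: (H i).
- by move=> i j jT; case: (H i) => _ _ _; apply; case: (H i.+1) => <-.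
- by rewrite all_flatten; apply/(all_nthP [::]) => i _; case: (H i).
Qed.

Variables (n K : nat).
Implicit Types (f g : {ffun 'I_n -> 'I_K.+1}).

Lemma nth_add_letter N f g T i : size T = n ->
  nth [::] (add_letter n N (part f) (part g) T) i =
  nth [::] T i ++ nseq (nth 0%N (part g) i - nth 0%N (part f) i) N.
Proof.
move=> sT; have [ni|ni] := ltnP i n; first by rewrite nth_mkseq.
by rewrite !nth_default ?size_part ?sT ?size_mkseq.
Qed.

Lemma filter_add_letter N f g T : T \in ssyt N f -> 
    all (fun r => r < N)%N (flatten T) ->
  map (below N) (add_letter n N (part f) (part g) T) = T.
Proof.
move=> Tf TN; have sT := size_ssyt Tf.
apply: (@eq_from_nth _ [::]) => [|i]; rewrite size_map size_mkseq // => ni.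
rewrite (nth_map [::]) ?size_mkseq // nth_add_letter // filter_cat filter_nseq.
rewrite ltnn cats0; apply/all_filterP.
by move: TN; rewrite all_flatten => /allP; apply; rewrite mem_nth ?sT.
Qed.

(** Induction on [N]: by strictness of the columns the cells containing the largest letter form a
    horizontal strip, and removing them leaves a tableau in the smaller letters. *)
Lemma mem_ssyt N g T : T \in ssyt N g <->
  [/\ sorted geq (part g), semistandard (part g) T &
      all (fun r => r < N)%N (flatten T)].
Proof.
elim: N g T => [|N IH] g T'.
  split=> [Tg|[_ [sT _ _] T0]].
    rewrite (ssyt_sorted Tg); move: Tg => /=; case: eqP => // ->.
    rewrite inE part0E => /eqP ->.
    have [|? ?] := (semistandardP (nseq n 0%N) (nseq n [::]) 0).2; last by [].
    by rewrite !size_nseq; split => // i; rewrite !nth_nseq !if_same.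
  (* No entry lies below 0, so every row is empty. *)
  have TE : T' = nseq n [::].
    apply: (@eq_from_nth _ [::]) => [|i iT].
      by rewrite size_nseq -(size_part g) -sT size_map.
    rewrite nth_nseq if_same.
    move: T0; rewrite all_flatten => /allP /(_ _ (mem_nth [::] iT)).
    by case: (nth _ _ _).
  rewrite /= ifT ?inE ?TE //; apply/eqP/part_inj; rewrite -sT TE part0E.
  by rewrite /shape map_nseq.
split=> [|[sg ss aN]].
  move=> Tg; have sg := ssyt_sorted Tg; have /ssytSP[f [T [fg Tf TE]]] := Tg.
  have /IH[_ ss aN] := Tf.
  have /semistandardP[sT H] := conj ss aN; rewrite size_part in sT.
  have [|? ?] := (semistandardP (part g) T' N.+1).2; last by split.
  rewrite {}TE size_mkseq size_part; split => // i; rewrite !nth_add_letter //.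
  have /hstripP fgi := fg; have [szi si ai ci] := H i.
  rewrite size_cat szi size_nseq subnKC ?(fgi i).1 //; split => //.
  - exact: sorted_leq_nseq.
  - rewrite all_cat all_nseq ltnSn orbT andbT.
    by apply: sub_all ai => r /=; apply: leqW.
  (* By the strip condition the cell above any cell of row [i.+1] belongs to the inner shape [f], so
     its entry is below [N]; hence strictness also holds at the new cells. *)
  - move=> j jg; have ji := leq_trans jg (fgi i).2.
    have [szi1 _ _ _] := H i.+1; rewrite !nth_cat szi szi1 ji.
    have [|fj] := ltnP j (nth 0%N (part f) i.+1); first exact: ci.
    rewrite nth_nseq ltn_sub2r ?(leq_ltn_trans fj) //.
    by move/(all_nthP 0%N): ai; apply; rewrite szi.
have /semistandardP[sT H] := conj ss aN; rewrite size_part in sT.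
have dec i : nth [::] T' i = below N (nth [::] T' i) ++
    nseq (nth 0%N (part g) i - size (below N (nth [::] T' i))) N.
  by have [<- si ai _] := H i; exact: sorted_filter_ltn.
pose l i := size (below N (nth [::] T' i)).
have lg i : (l i <= nth 0%N (part g) i)%N.
  by have [<- _ _ _] := H i; rewrite /l size_filter count_size.
(* Otherwise the entry above the last cell of row [i.+1] would be [N], yet strictly smaller than an
   entry that is at most [N]. *)
have gl i : (nth 0%N (part g) i.+1 <= l i)%N.
  have [_ _ _ ci] := H i; case gE: (nth 0%N (part g) i.+1) => [|j] //.
  have /ci cij : (j < nth 0%N (part g) i.+1)%N by rewrite gE.
  have [szi1 _ ai1 _] := H i.+1.
  have jN : (nth 0 (nth [::] T' i.+1) j <= N)%N.
    by rewrite -ltnS; move/(all_nthP 0%N): ai1; apply; rewrite szi1 gE.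
  rewrite ltnNge; apply/negP => lj.
  have := leq_trans cij jN; rewrite dec nth_cat -/(l i) [(j < l i)%N]ltnNge lj /= nth_nseq.
  have jg : (j < nth 0%N (part g) i)%N by rewrite -gE nth_sorted_geq.
  by rewrite ltn_sub2r ?ltnn ?(leq_ltn_trans lj jg).
pose f : {ffun 'I_n -> 'I_K.+1} := [ffun i : 'I_n => inord (l i)].
have lf i : nth 0%N (part f) i = l i.
  have [ni|ni] := ltnP i n.
    rewrite (nth_part f (Ordinal ni)) ffunE inordK //= ltnS (leq_trans (lg i)) //.
    by rewrite (nth_part g (Ordinal ni)) -ltnS.
  rewrite nth_default ?size_part //; apply/esym/eqP.
  by rewrite -leqn0 (leq_trans (lg i)) // nth_default // size_part.
pose T := [seq below N r | r <- T'].
have TE i : nth [::] T i = below N (nth [::] T' i).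
  have [Ti|Ti] := ltnP i (size T'); first exact: nth_map.
  by rewrite !nth_default // size_map.
have sT1 : size T = n by rewrite size_map.
apply/ssytSP; exists f, T; split.
- by apply/hstripP => i; rewrite lf.
- have sf : sorted geq (part f).
    by apply/(sortedP 0%N) => i _; rewrite /= !lf (leq_trans (lg _)).
  have [|ssT aT] := (semistandardP (part f) T N).2; last by apply/IH; split.
  rewrite sT1 size_part; split => // i; rewrite !TE lf filter_all; split => //.
    by have [_ si _ _] := H i; exact: (sorted_filter leq_trans).
  rewrite lf => j jl; have jg := leq_trans jl (lg i.+1).
  have below_nth i1 : (j < l i1)%N ->
      nth 0%N (below N (nth [::] T' i1)) j = nth 0%N (nth [::] T' i1) j.
    by move=> jl1; rewrite [in RHS]dec nth_cat -/(l i1) jl1.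
  by have [_ _ _ ci] := H i; rewrite !below_nth ?jl ?ci ?(leq_trans jg).
apply: (@eq_from_nth _ [::]) => [|i]; rewrite sT ?size_mkseq // => ni.
by rewrite nth_add_letter // TE lf -dec.
Qed.

(** Removing the letters [N] recovers the previous tableau, and its shape recovers the inner
    partition. *)
Lemma ssyt_uniq N g : uniq (ssyt N g).
Proof.
elim: N g => [|N IH] g /=; first by case: eqP.
apply: allpairs_uniq_dep => [|f _|]; rewrite ?filter_uniq -?enumT ?enum_uniq //.
move=> _ _ /allpairsPdep[f1 [T1 [_ T1f ->]]] /allpairsPdep[f2 [T2 [_ T2f ->]]] /=.
have /mem_ssyt[_ [s1 _ _] a1] := T1f; have /mem_ssyt[_ [s2 _ _] a2] := T2f.
move=> /(congr1 (map (below N))); rewrite !filter_add_letter // => T12.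
have f12 : f1 = f2 by apply: part_inj; rewrite -s1 -s2 T12.
by rewrite T12 f12.
Qed.

End Tableaux.

(** * Congruence of power series at the divisors of a monomial *)

Section Congruence.
Variable R : comNzRingType.
Implicit Types (F G : powser R) (m a : {cmonom nat}).

(* [a] ranges over the divisors of [m], which makes this a ring congruence. *)
Definition eq_below m F G :=
  forall a, (exists b, mmul a b = m) -> pscoef F a = pscoef G a.

Lemma eq_below_coef m F G : eq_below m F G -> pscoef F m = pscoef G m.
Proof. by apply; exists mone; exact: mulm1. Qed.

Lemma eq_below_refl m F : eq_below m F F.
Proof. by []. Qed.

Lemma eq_belowD m F F' G G' :
  eq_below m F F' -> eq_below m G G' -> eq_below m (F + G) (F' + G').
Proof. by move=> FF GG a am /=; rewrite FF ?GG. Qed.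

Lemma eq_belowM m F F' G G' :
  eq_below m F F' -> eq_below m G G' -> eq_below m (F * G) (F' * G').
Proof.
move=> FF GG a [c am]; have [D [uD Da]] := divisors_bounded a.
rewrite [LHS](psmulE _ _ uD Da) [RHS](psmulE _ _ uD Da).
apply: eq_bigr => u _; apply: eq_bigr => v /eqP uv; congr (_ * _).
  by apply: FF; exists (mmul v c); rewrite mulmA uv.
by apply: GG; exists (mmul u c); rewrite mulmA (mulmC v) uv.
Qed.

Lemma eq_below_sum m (I : Type) (r : seq I) (F G : I -> powser R) :
  (forall i, eq_below m (F i) (G i)) ->
  eq_below m (\sum_(i <- r) F i) (\sum_(i <- r) G i).
Proof. by move=> FG; elim/big_ind2: _ => // *; exact: eq_belowD. Qed.

Lemma eq_below_prod m (I : Type) (r : seq I) (F G : I -> powser R) :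
  (forall i, eq_below m (F i) (G i)) ->
  eq_below m (\prod_(i <- r) F i) (\prod_(i <- r) G i).
Proof. by move=> FG; elim/big_ind2: _ => // *; exact: eq_belowM. Qed.

Lemma eq_below_det m p (M N : 'M[powser R]_p) :
  (forall i j, eq_below m (M i j) (N i j)) -> eq_below m (\det M) (\det N).
Proof.
move=> MN; apply: eq_below_sum => s; apply: eq_belowM => //.
exact: eq_below_prod.
Qed.

Lemma eq_below_sermul m (f f' g g' : nat -> powser R) :
  (forall j, eq_below m (f j) (f' j)) -> (forall j, eq_below m (g j) (g' j)) ->
  forall j, eq_below m (sermul f g j) (sermul f' g' j).
Proof. by move=> ff gg j; apply: eq_below_sum => i; exact: eq_belowM. Qed.

Lemma eq_belowX0 m r : m r = 0%N -> eq_below m (psX R r) 0.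
Proof.
move=> mr a [b abm] /=; rewrite mul0rn; case: eqP => // ar.
by move: mr; rewrite -abm ar cmM ucmE eqxx.
Qed.

Lemma mcoef_bound m : exists N, forall r, (N <= r)%N -> m r = 0%N.
Proof.
exists (\max_(i <- finsupp m : seq nat) i).+1 => r rN.
apply/eqP; rewrite cmE_eq0; apply/negP => rm.
by move: rN; rewrite ltnNge (@leq_bigmax_seq _ _ xpredT id).
Qed.

Definition xfactor_trunc N : nat -> powser R :=
  \big[@sermul (powser R)/@ser1 (powser R)]_(r < N) sergeo (psX R r).

(** If [x_r] does not divide [m], it is congruent to 0, so the factor [sergeo (psX R r)] is
    congruent to 1. *)
Lemma eq_below_xfactor_trunc m N M j :
    (forall r, (N <= r)%N -> m r = 0%N) -> (N <= M)%N ->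
  eq_below m (xfactor_trunc M j) (xfactor_trunc N j).
Proof.
move=> mN /subnKC <-; elim: (M - N)%N j => [|p IH] j; first by rewrite addn0.
rewrite addnS /xfactor_trunc big_ord_recr /= -[X in eq_below _ _ (X j)]sermul1.
rewrite sermulC; move: j; apply: eq_below_sermul => // -[|k].
  by rewrite /sergeo /ser1 expr0.
rewrite /sergeo /ser1 /= exprS mulr0n -[X in eq_below _ _ X](mul0r (psX R (N + p) ^+ k)).
apply: eq_belowM; last exact: eq_below_refl.
by apply: eq_belowX0; apply: mN; rewrite leq_addr.
Qed.

End Congruence.

Lemma eq_below_xfactor (R : realType) (m : {cmonom nat}) N j :
    (forall r, (N <= r)%N -> m r = 0%N) ->
  eq_below m (xfactor R j) (xfactor_trunc R N j).
Proof.
move=> mN a am /=; apply: lim_near_cst => //.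
exists N => // M /= NM; exact: (@eq_below_xfactor_trunc R m N M j mN NM a am).
Qed.

(** * Trailing zero parts in Schur functions *)

Section Padding.
Variable R : realType.
Implicit Types (l : seq nat) (m : {cmonom nat}).

(** Homogeneity limits the shapes that can contribute to a given monomial. *)
Lemma schur_coef_neq0 l m : pscoef (schur R l) m != 0 -> sumn l = mdeg m.
Proof.
move=> lm; have [T [<- _ _] Tm] := @fsbigN1 R 0 +%R _ _ [set T | semistandard l T]
  (fun m T => pscoef (\prod_(r <- flatten T) psX R r) m) m lm.
have /(_ m Tm) -> : pshomog (size (flatten T)) (\prod_(r <- flatten T) psX R r).
  elim: (flatten T) => [|r s IH]; first by rewrite big_nil; exact: pshomog1.
  rewrite big_cons; exact: (pshomogM (@pshomogX _ r) IH).
by rewrite size_flatten.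
Qed.

Lemma semistandard_rcons l T :
  semistandard (rcons l 0%N) (rcons T [::]) <-> semistandard l T.
Proof.
have nthT i : nth [::] (rcons T [::]) i = nth [::] T i.
  rewrite nth_rcons; case: ltngtP => // iT; last by rewrite nth_default ?iT.
  by rewrite nth_default // ltnW.
split=> -[sT so co]; split.
- by move: sT; rewrite /shape map_rcons => /rcons_inj[].
- by move: so; rewrite all_rcons => /andP[].
- by move=> i j; have := co i j; rewrite !nthT.
- by rewrite /shape map_rcons -sT.
- by rewrite all_rcons.
- by move=> i j; rewrite !nthT; exact: co.
Qed.

Lemma schur_rcons0 l : schur R (rcons l 0%N) = schur R l.
Proof.
apply: powserP => m /=.
rewrite (reindex_fsbig (rcons^~ [::]) [set T | semistandard l T]
  [set T | semistandard (rcons l 0%N) T]); last first.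
  split=> [T /= /semistandard_rcons //|T1 T2 _ _ /rcons_inj[]//|].
  move=> T /= sT; case/lastP: T sT => [[]|T r sT]; first by case: l.
  have r0 : r = [::].
    case: sT; rewrite /shape map_rcons => /rcons_inj[_ /eqP].
    by rewrite size_eq0 => /eqP.
  by exists T; rewrite ?r0 //; apply/semistandard_rcons; rewrite -r0.
by apply: eq_fsbigr => T _; rewrite flatten_rcons cats0.
Qed.

Variables (alpha beta : nat -> R) (gamma : R).

Lemma sermul0 (a b : nat -> R) : sermul a b 0 = a 0%N * b 0%N.
Proof. by rewrite /sermul big_ord1. Qed.

Lemma ext_h0 : ext_h alpha beta gamma 0 = 1.
Proof.
rewrite /ext_h /zfactor; apply: lim_near_cst => //; apply: nearW => N.
rewrite /zfactor_trunc sermul0 /exp_coeff /= expr0 fact0 invr1 !mul1r.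
elim: N => [|N IH]; first by rewrite big_ord0.
by rewrite big_ord_recr /= !sermul0 IH !mul1r.
Qed.

Lemma ext_schurE p l : size l = p -> ext_schur alpha beta gamma l =
  \det (\matrix_(i < p, j < p)
    ext_h alpha beta gamma ((nth 0%N l i)%:Z - i%:Z + j%:Z)).
Proof. by move <-. Qed.

(** The last row of the larger determinant is [0, ..., 0, 1], since [ext_h] vanishes at negative
    indices and is 1 at 0; expand along it. *)
Lemma ext_schur_rcons0 l :
  ext_schur alpha beta gamma (rcons l 0%N) = ext_schur alpha beta gamma l.
Proof.
rewrite (ext_schurE (size_rcons _ _)) (expand_det_row _ ord_max).
rewrite (bigD1 ord_max) //= big1 ?addr0 => [|j jm]; last first.
  rewrite !mxE /= nth_rcons ltnn eqxx sub0r addrC.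
  have : (j < size l)%N by rewrite ltn_neqAle -ltnS ltn_ord andbT.
  rewrite -ltz_nat -subr_lt0.
  by case: (_ - _) => // p _; rewrite mul0r.
rewrite !mxE /= nth_rcons ltnn eqxx sub0r addNr ext_h0 mul1r.
rewrite /cofactor -signr_odd addnn odd_double expr0 mul1r; congr (\det _).
have bumpE (i : 'I_(size l)) : bump (size l) i = i by rewrite /bump leqNgt ltn_ord.
by apply/matrixP => i j; rewrite !mxE /= !bumpE nth_rcons ltn_ord.
Qed.

(** Passes from padded lists to the lists without zero parts required by [is_partition]; not to be
    confused with horizontal strips. *)
Definition strip l : seq nat := [seq v <- l | 0 < v]%N.

Lemma sorted_geq_pad l : sorted geq l ->
  l = strip l ++ nseq (size l - size (strip l)) 0%N.
Proof.
rewrite /strip; elim: l => //= a l IH al; case: a al => [|a] al /=.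
  have l0 : all (pred1 0%N) l.
    have /(order_path_min _) : path geq 0%N l := al.
    have geq_trans : transitive geq by move=> x y z /= yx zy; exact: leq_trans zy yx.
    by move=> /(_ geq_trans); apply: sub_all => c /=; rewrite leqn0.
  rewrite (_ : [seq v <- l | 0 < v]%N = [::]).
    by rewrite subn0 /= {1}(all_pred1P _ _ l0).
  apply/eqP; rewrite -(negbK (_ == _)) -has_filter -all_predC.
  by apply: sub_all l0 => c /eqP ->.
by rewrite subSS -IH // (path_sorted al).
Qed.

Lemma pad_rcons l k : l ++ nseq k.+1 0%N = rcons (l ++ nseq k 0%N) 0%N.
Proof. by rewrite -cats1 -catA; congr (_ ++ _); elim: k => //= k <-. Qed.

Lemma schur_strip l : sorted geq l -> schur R (strip l) = schur R l.
Proof.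
move/sorted_geq_pad => {2}->; elim: (_ - _)%N => [|k IH]; first by rewrite cats0.
by rewrite pad_rcons schur_rcons0.
Qed.

Lemma ext_schur_strip l : sorted geq l ->
  ext_schur alpha beta gamma (strip l) = ext_schur alpha beta gamma l.
Proof.
move/sorted_geq_pad => {2}->; elim: (_ - _)%N => [|k IH]; first by rewrite cats0.
by rewrite pad_rcons ext_schur_rcons0.
Qed.

End Padding.

(** * Coefficients of the Toeplitz determinant of the symbol *)

Lemma pscoef_scale1M (R : comNzRingType) (c : R) (F : powser R) m :
  pscoef (c%:A * F) m = c * pscoef F m.
Proof. by rewrite -scalerAl mul1r. Qed.

Lemma wdet_scalar (R : comNzRingType) n K (z : nat -> R) l :
  wdet n K (fun i => (z i)%:A : powser R) l = (wdet n K z l)%:A.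
Proof.
rewrite /wdet -[RHS]/(in_alg (powser R) _) -det_map_mx; congr (\det _).
apply/matrixP => i j; rewrite !mxE /wcoef.
by case: (K%:Z - _) => p //=; rewrite scale0r.
Qed.

Section Final.
Variables (R : realType) (alpha beta : nat -> R) (gamma : R).
Implicit Types (l : seq nat) (m : {cmonom nat}).

Let h := ext_h alpha beta gamma.

(** The polynomial [\sum_(k <= K) h_k z ^ k] in the indexing of [wcoef]. Truncation at [K] makes it
    a series in [1/z], so it can be multiplied by [xfactor] with [sermul]. *)
Definition reversed_h K i : R := h (K%:Z - i%:Z).

Lemma wcoef_reversed_h K (k : int) : k <= K%:Z -> wcoef K (reversed_h K) k = h k.
Proof.
rewrite -subr_ge0 /wcoef /reversed_h; case E: (K%:Z - k) => [p|p] // _.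
by rewrite -E opprB addrC subrK.
Qed.

Lemma wdet_reversed_h n K l : size l = n ->
    (forall i, (nth 0%N l i + n <= K)%N) ->
  wdet n K (reversed_h K) l = ext_schur alpha beta gamma l.
Proof.
move=> sl lK; rewrite (ext_schurE _ _ _ sl); congr (\det _).
apply/matrixP => i j; rewrite !mxE wcoef_reversed_h //.
rewrite addrAC lerBlDr -!PoszD lez_nat (leq_trans _ (leq_addr _ _)) //.
by rewrite (leq_trans _ (lK i)) // leq_add2l ltnW.
Qed.

(** As [xfactor] is homogeneous, only its coefficient of index [mdeg m] contributes at [m]. It is
    multiplied by [h (k + mdeg m)], which the truncation at [K] retains. *)
Lemma symbol_coefE K (k : int) m : k + (mdeg m)%:Z <= K%:Z ->
  pscoef (symbol_coef alpha beta gamma k) m =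
  pscoef (wcoef K (sermul (fun i => (reversed_h K i)%:A) (xfactor R)) k) m.
Proof.
move=> kK; transitivity (h (k + (mdeg m)%:Z) * pscoef (xfactor R (mdeg m)) m).
  have xm p : p.1%:Z - p.2%:Z = k -> pscoef (xfactor R p.2) m != 0 ->
      (k + (mdeg m)%:Z = p.1%:Z) /\ p.2 = mdeg m.
    by move=> <- /xfactor_homog ->; rewrite subrK.
  rewrite -[LHS]/(\sum_(p \in [set p : nat * nat | p.1%:Z - p.2%:Z = k])
    zfactor alpha beta gamma p.1 * pscoef (xfactor R p.2) m).
  case E: (k + (mdeg m)%:Z) => [q|q].
    rewrite (fsbigE [:: (q, mdeg m)]) // => [|p|p pk].
    - rewrite big_mkcond big_seq1 ifT //; apply/mem_set => /=.
      by rewrite -E addrK.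
    - by rewrite /= inE => /eqP ->; rewrite /= -E addrK.
    rewrite inE => pq; have [->|/(xm _ pk)[]] := eqVneq (pscoef (xfactor R p.2) m) 0.
      by rewrite mulr0.
    rewrite E => -[qp] mp; case/eqP: pq.
    by rewrite [p]surjective_pairing mp -qp.
  rewrite mul0r; apply: fsbig1 => p pk.
  have [->|/(xm _ pk)[]] := eqVneq (pscoef (xfactor R p.2) m) 0.
    by rewrite mulr0.
  by rewrite E.
rewrite /wcoef; have : (mdeg m)%:Z <= K%:Z - k by rewrite lerBrDl.
case E: (K%:Z - k) => [p|p] // mp; rewrite lez_nat in mp.
rewrite /sermul pscoef_sum.
(* With [p = K - k], this position in [reversed_h K] carries [h (k + mdeg m)]. *)
have pm : (p - mdeg m < p.+1)%N by rewrite ltnS leq_subr.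
rewrite (bigD1 (Ordinal pm)) // big1 => [|i im].
  rewrite (pscoef_scale1M (reversed_h K (Ordinal pm))).
  have -> : (p - Ordinal pm)%N = mdeg m by exact: subKn.
  rewrite [RHS]addr0 /reversed_h; congr (h _ * _).
  by rewrite /= -subzn // -E !opprB addrCA [K%:Z + _]addrC subrK addrC.
rewrite (pscoef_scale1M (reversed_h K i)).
have [->|] := eqVneq (pscoef (xfactor R (p - i)) m) 0; first by rewrite mulr0.
move/(@xfactor_homog R (p - i) m) => mi; case/andP: im => _ /eqP[].
by apply: val_inj; rewrite /= mi subKn // -ltnS.
Qed.

(** A tableau with an entry [r >= N] contributes nothing at [m], because [x_r] does not divide
    [m]. *)
Lemma pscoef_ssyt n K N (g : {ffun 'I_n -> 'I_K.+1}) m :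
    (forall r, (N <= r)%N -> m r = 0%N) -> sorted geq (part g) ->
  pscoef (\sum_(T <- ssyt N g) \prod_(r <- flatten T) psX R r) m =
  pscoef (schur R (part g)) m.
Proof.
move=> mN sg; rewrite pscoef_sum /= (fsbigE (ssyt N g)) ?ssyt_uniq //.
- rewrite [LHS]big_seq [RHS]big_seq_cond; apply: eq_bigl => T.
  by case: (boolP (T \in _)) => // /mem_ssyt[_ sT _]; apply/esym/mem_set.
- by move=> T /mem_ssyt[].
move=> T sT; apply: contraNeq => Tm; apply/mem_ssyt; split => //.
apply/allP => r rT; rewrite ltnNge; apply: contraNN Tm => Nr; apply/eqP.
have rX := eq_belowX0 R (mN _ Nr).
rewrite (perm_big _ (perm_to_rem rT)) /= big_cons.
by rewrite (eq_below_coef (eq_belowM rX (@eq_below_refl _ m _))) mul0r /= mul0rn.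
Qed.

Lemma toeplitz_coef n m :
  pscoef (toeplitz_det n (symbol_coef alpha beta gamma)) m =
  \sum_(g : {ffun 'I_n -> 'I_(mdeg m + n).+1} | sorted geq (part g))
    ext_schur alpha beta gamma (part g) * pscoef (schur R (part g)) m.
Proof.
(* This [K] serves twice: Toeplitz indices satisfy [j - i <= n], as [symbol_coefE] requires at the
   divisors of [m], and contributing shapes have parts at most [mdeg m], as [wdet_reversed_h]
   requires. *)
set K := (mdeg m + n)%N; have [N mN] := mcoef_bound m.
pose b i : powser R := (reversed_h K i)%:A.
transitivity (pscoef (wdet n K (sermul b (xfactor_trunc R N)) (nseq n 0%N)) m).
  apply/eq_below_coef/eq_below_det => i j a [c acm].
  rewrite !mxE nth_nseq if_same sub0r [- _ + _]addrC (@symbol_coefE K); last first.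
    rewrite addrAC lerBlDr -!PoszD lez_nat /K -acm mdegM (leq_trans _ (leq_addr _ _)) //.
    by rewrite addnC leq_add ?leq_addr // ltnW.
  rewrite /wcoef; case: (K%:Z - _) => // p.
  apply: (@eq_below_sermul R m); last by exists c.
    by move=> j0; exact: eq_below_refl.
  by move=> j0; exact: eq_below_xfactor.
rewrite wdet_prod_geo pscoef_sum [RHS]big_mkcond; apply: eq_bigr => g _.
rewrite wdet_scalar pscoef_scale1M; case: ifPn => [sg|nsg]; last first.
  case ET: (ssyt N g) => [|T s]; first by rewrite big_nil /= mul0rn mulr0.
  by case/negP: nsg; apply: (@ssyt_sorted _ _ N g T); rewrite ET mem_head.
rewrite pscoef_ssyt //; have [->|gm] := eqVneq (pscoef (schur R (part g)) m) 0.
  by rewrite !mulr0.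
congr (_ * _); apply: wdet_reversed_h => [|i]; first exact: size_part.
rewrite leq_add2r -(schur_coef_neq0 gm) sumnE.
have [ni|ni] := ltnP i n; last by rewrite nth_default ?size_part.
rewrite (big_nth 0%N) size_part big_mkord.
by rewrite (bigD1 (Ordinal ni)) //= leq_addr.
Qed.

End Final.

(** * Partitions and their zero-padded forms *)

Section Strip.
Variables (n K : nat).
Implicit Types (g : {ffun 'I_n -> 'I_K.+1}) (l : seq nat).

Lemma strip_partition l : sorted geq l -> is_partition (strip l).
Proof.
move=> sl; rewrite /is_partition mem_filter ltnn /= andbT.
by apply: sorted_filter sl => x y z /= yx zy; exact: leq_trans zy yx.
Qed.

(** A sorted list has its zeros at the end, and their number is known from the length [n]. *)
Lemma strip_part_inj :
  {in [pred g | sorted geq (part g)] &, injective (fun g => strip (part g))}.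
Proof.
move=> f g sf sg /= fg; apply: part_inj.
by rewrite (sorted_geq_pad sf) (sorted_geq_pad sg) !size_part fg.
Qed.

Lemma partition_strip l : is_partition l -> (size l <= n)%N -> (sumn l <= K)%N ->
  exists2 g : {ffun 'I_n -> 'I_K.+1}, sorted geq (part g) & strip (part g) = l.
Proof.
move=> /andP[sl l0] ln lK.
pose g : {ffun 'I_n -> 'I_K.+1} := [ffun i : 'I_n => inord (nth 0%N l i)].
have lg : part g = l ++ nseq (n - size l) 0%N.
  apply: (@eq_from_nth _ 0%N) => [|i].
    by rewrite size_part size_cat size_nseq subnKC.
  rewrite size_part => ni; rewrite (nth_part g (Ordinal ni)) ffunE nth_cat inordK.
    by case: ltnP => // il; rewrite nth_nseq if_same nth_default.
  rewrite ltnS (leq_trans _ lK) //=; have [il|il] := ltnP i (size l).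
    by rewrite sumnE (big_nth 0%N) big_mkord (bigD1 (Ordinal il)) //= leq_addr.
  by rewrite nth_default.
exists g.
  apply/(sortedP 0%N) => i _ /=; rewrite lg !nth_cat !nth_nseq !if_same.
  case: (ltnP i.+1) => // il; rewrite (ltnW il).
  by move/(sortedP 0%N): sl; apply.
rewrite lg /strip filter_cat filter_nseq cats0; apply/all_filterP/allP => v vl.
by rewrite lt0n; apply: contraNneq l0 => <-.
Qed.

End Strip.

Theorem theorem4 (R : realType) (alpha beta : nat -> R) (gamma : R) (n : nat)
    (alpha_ge0 : forall i, 0 <= alpha i) (beta_ge0 : forall i, 0 <= beta i)
    (alpha_sum : cvgn (series alpha)) (beta_sum : cvgn (series beta))
    (gamma_ge0 : 0 <= gamma) (n_ge1 : (1 <= n)%N) :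
  has_pssum [set lam : seq nat | is_partition lam /\ (size lam <= n)%N]
    (fun lam => ext_schur alpha beta gamma lam *: schur R lam)
    (toeplitz_det n (symbol_coef alpha beta gamma)).
Proof.
have coef0 lam m : ext_schur alpha beta gamma lam * pscoef (schur R lam) m != 0 ->
    sumn lam = mdeg m.
  by rewrite mulf_eq0 negb_or => /andP[_]; exact: schur_coef_neq0.
(* A finite list of partitions that contains, by homogeneity, every partition with at most [n] parts
   contributing at [m]; it uses the same box as [toeplitz_coef]. *)
pose r (m : {cmonom nat}) := [seq strip (part g) |
  g <- [seq g <- enum {ffun 'I_n -> 'I_(mdeg m + n).+1} | sorted geq (part g)]].
have mem_r m lam : is_partition lam -> (size lam <= n)%N -> sumn lam = mdeg m ->
    lam \in r m.
  move=> pl ln lm; have lK : (sumn lam <= mdeg m + n)%N by rewrite lm leq_addr.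
  have [g sg <-] := partition_strip pl ln lK.
  by apply/mapP; exists g; rewrite // mem_filter sg mem_enum.
split=> [m|].
  apply: (@sub_finite_set _ _ [set` r m]); last exact: finite_seq.
  by move=> lam [[/= pl ln] /coef0]; exact: mem_r.
apply: powserP => m; rewrite toeplitz_coef.
rewrite -[LHS]/(\sum_(lam \in [set lam | is_partition lam /\ (size lam <= n)%N])
  (ext_schur alpha beta gamma lam * pscoef (schur R lam) m)).
have rP lam : lam \in r m -> is_partition lam /\ (size lam <= n)%N.
  move=> /mapP[g]; rewrite mem_filter => /andP[sg _] ->.
  split; first exact: strip_partition.
  by rewrite size_filter (leq_trans (count_size _ _)) ?size_part.
rewrite (fsbigE (r m)) => [||lam /rP //|lam [pl ln]]; last 2 first.
- rewrite map_inj_in_uniq ?filter_uniq -?enumT ?enum_uniq // => f g.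
  rewrite !mem_filter => /andP[sf _] /andP[sg _]; exact: strip_part_inj.
- by apply: contraNeq => /coef0; exact: mem_r.
rewrite big_seq_cond (eq_bigl (fun lam => lam \in r m)) => [|lam]; last first.
  by case: (boolP (lam \in r m)) => // /rP lamP; apply/mem_set.
rewrite -big_seq big_map big_filter big_enum_cond; apply: eq_bigr => g sg.
by rewrite schur_strip ?ext_schur_strip.
Qed.
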